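(* Suppose the price sensitivity function is linear, $g(p)=\beta-\alpha p$ with $\alpha,\beta>0$, and that $\mu_{\max}:=\beta-\alpha p_{\min}>\lambda$ and $\mu_{\min}:=\beta-\alpha p_{\max}>0$. Then there exists a policy that optimizes (maximizes) the relaxed objective $$C_{\mathrm{rel}}=\sum_{i=0}^{\infty}\pi_i p_i-w\sum_{i=1}^{\infty} i\,\pi_i$$ and that is of the form $$p_i=\begin{cases}p_{\max} & \text{for } i<\ell^*,\\ p^* & \text{for } i=\ell^*,\\ p_{\min} & \text{for } i>\ell^*,\end{cases}$$ where $\ell^*\in\mathbb{N}\cup\{\infty\}$ and $p^*\in[p_{\min},p_{\max}]$.
   Context: Loss model (continuous time). Servers arrive according to a Poisson process of rate $\lambda>0$ and wait in an infinite-buffer queue until matched with a customer. When the platform posts price $p$, the time until the next customer arrival is exponential with mean $1/g(p)$. An arriving customer is immediately matched with the head-of-line server if there is one; customers arriving when no servers are present are lost. Prices lie in $[p_{\min},p_{\max}]$ with $0<p_{\min}<p_{\max}$. A policy is a sequence $(p_i,\ i\in\mathbb{N})$, $\mathbb{N}=\{1,2,\dots\}$, with $p_i\in[p_{\min},p_{\max}]$, where $p_i$ is the price posted when there are $i$ servers in the queue; the price when there are no servers is fixed to $p_0=p_{\max}$. Write $\mu_i:=g(p_i)$. Under a policy, the number of servers is a birth-death Markov chain on $\{0,1,2,\dots\}$ with transition rate $\lambda$ from $i$ to $i+1$ ($i\ge 0$) and $\mu_i$ from $i$ to $i-1$ ($i\ge 1$). It is an implicit constraint on policies that this chain is positive recurrent;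 $\pi=(\pi_i)_{i\ge0}$ denotes its stationary distribution. $w>0$ is a given weight. The optimization of $C_{\mathrm{rel}}$ is over all policies. *)

(* Defs.v *)
From HB Require Import structures.
From mathcomp Require Import all_boot all_order all_algebra.
From mathcomp Require Import all_classical all_reals all_analysis.

Set Implicit Arguments.
Unset Strict Implicit.
Unset Printing Implicit Defensive.

Import Order.TTheory GRing.Theory Num.Theory.

Local Open Scope ring_scope.

(* The value mu 0 is never used: customers finding no server are lost. *)
Definition bd_rate (R : realType) (lam : R) (mu : nat -> R) (i j : nat) : R :=
  if j == i.+1 then lam else if i == j.+1 then mu i else 0.

(* bd_rate vanishes unless the two states are neighbours, so summing over the
   states below i.+2 captures every transition out of, or into, state i. *)
Definition exit_rate (R : realType) (lam : R) (mu : nat -> R) (i : nat) : R :=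
  \sum_(j < i.+2) bd_rate lam mu i j.

(* With Y the embedded jump chain started at x and N = inf {n >= 1 | Y_n = x},
   excursion lam mu x n j is the probability that Y_n = j and n < N. *)
Fixpoint excursion (R : realType) (lam : R) (mu : nat -> R) (x n j : nat) : R :=
  match n with
  | 0 => (j == x)%:R
  | m.+1 =>
      if j == x then 0
      else \sum_(i < j.+2)
             excursion lam mu x m i * (bd_rate lam mu i j / exit_rate lam mu i)
  end.

(* Expected time of the first return to x: the expected sum, over the jumps
   n < N, of the holding times in Y_n, which have mean 1 / exit_rate (Y_n). If
   the chain may fail to return, the sum also counts the holding times of the
   nonreturning paths; it is then +oo as soon as the exit rates are bounded,
   as they are under a pricing policy with prices in a bounded range. *)
Definition mean_return_time (R : realType) (lam : R) (mu : nat -> R) (x : nat)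
    : \bar R :=
  (\sum_(0 <= n <oo) \sum_(0 <= i <oo)
     (excursion lam mu x n i / exit_rate lam mu i)%:E)%E.

Definition positive_recurrent (R : realType) (lam : R) (mu : nat -> R) : Prop :=
  forall x : nat, (mean_return_time lam mu x < +oo)%E.

Definition stationary (R : realType) (lam : R) (mu : nat -> R) (pi : nat -> R)
    : Prop :=
  [/\ forall i, 0 <= pi i,
      (\sum_(0 <= i <oo) (pi i)%:E = 1)%E &
      forall j, pi j * exit_rate lam mu j
                = \sum_(i < j.+2) pi i * bd_rate lam mu i j].

Definition policy (R : realType) (lam pmin pmax : R) (g : R -> R)
    (p : nat -> R) : Prop :=
  [/\ p 0%N = pmax,
      forall i : nat, (1 <= i)%N -> pmin <= p i <= pmax &
      positive_recurrent lam (g \o p)].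

(* Extended-real valued, since positive recurrence alone does not make the mean
   number of servers finite. *)
Definition C_rel (R : realType) (w : R) (p pi : nat -> R) : \bar R :=
  (\sum_(0 <= i <oo) (pi i * p i)%:E
   - w%:E * \sum_(1 <= i <oo) (i%:R * pi i)%:E)%E.

Definition optimal_policy (R : realType) (lam w pmin pmax : R) (g : R -> R)
    (p : nat -> R) : Prop :=
  policy lam pmin pmax g p /\
  exists2 pi : nat -> R, stationary lam (g \o p) pi &
    forall q rho : nat -> R,
      policy lam pmin pmax g q -> stationary lam (g \o q) rho ->
      (C_rel w q rho <= C_rel w p pi)%E.

(* l = None encodes an infinite threshold. *)
Definition threshold_price (R : realType) (pmin pmax : R) (l : option nat)
    (pstar : R) (i : nat) : R :=
  match l with
  | Some k => if (i < k)%N then pmax else if i == k then pstar else pmin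
  | None => pmax
  end.

(* Main.v *)
Require Import Defs.
From mathcomp Require Import all_boot all_order all_algebra.
From mathcomp Require Import all_classical all_reals all_analysis.
From mathcomp Require Import ring lra.

Import Order.TTheory GRing.Theory Num.Theory.
Local Open Scope ring_scope.

Import numFieldNormedType.Exports.
Local Open Scope classical_set_scope.

(** Linearity of [g] makes the revenue depend on the policy only through the
    idle probability: since [mu_i pi_i = lam pi_(i-1)], the sum of
    [pi_i p_i = pi_i (beta - mu_i) / alpha] telescopes to
    [(beta - lam) / alpha - (mumin / alpha) pi_0] (lemma [revenue]). Maximizing
    the objective therefore means minimizing [c pi_0 + w E[N]] with
    [c = mumin / alpha], over the distributions whose consecutive ratios
    [pi_(i+1) / pi_i] lie in [[r, s]], where [r = lam / mumax < 1] and
    [s = lam / mumin].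

    Fix [a = pi_0]. The upper bound [s] on the ratios gives
    [P(N >= j) >= 1 - a (1 + s + ... + s^(j-1))], and the lower bound [r] gives
    [E (N - k)^+ >= r / (1 - r) P(N >= k)]. Summing the former over [1 <= j <= k]
    and adding the latter bounds [E[N]] below by a function of [a] that is affine
    and nonincreasing, one for each [k] (lemma [mean_bound_lower]). The envelope of
    these lines has its kinks at the bang-bang distributions, with ratio [s] for
    the first [K] steps and [r] afterwards, and the line of index [K] is attained
    there (lemma [mean_bound_attained]); the line of index [K.+1] meets it at
    the same point (lemma [mean_boundS_bang_bang]).

    Along the line of index [k] the cost [c a + w E[N]] has slope
    [c - w mean_slope k]. This is positive at [k = 0], and tends to [-oo] because
    [mean_slope k >= k]. At the first [K] where the sign changes between [K] and
    [K.+1], the cost is bounded below by two lines that meet at the bang-bang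
    distribution of index [K], of which the left one is nonincreasing and the
    right one nondecreasing, so that this distribution is optimal. It
    is the stationary distribution of the threshold policy with a finite
    threshold [K.+1] and [p* = pmin].

    The bang-bang policy is admissible because a chain with a positive
    stationary distribution is positive recurrent: the expected number of visits
    to [j] during an excursion from [x] is at most the ratio of the stationary
    jump rates out of [j] and [x] (lemma [sum_excursion_le]). *)

(** * Real series as extended-real series *)

Lemma cvg_nneseries_EFin {R : realType} (x : nat -> R) (l : R) :
  series x @ \oo --> l -> (\sum_(0 <= i <oo) (x i)%:E = l%:E)%E.
Proof.
move=> xl.
have -> : (fun n => \sum_(0 <= i < n) (x i)%:E)%E = EFin \o series x.
  by apply/funext => n; rewrite sumEFin.
by rewrite EFin_lim ?(cvg_lim _ xl)//; exact: cvgP xl.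
Qed.

Lemma nneseries_EFin_cvg {R : realType} (x : nat -> R) (l : R) :
  (forall i, 0 <= x i) -> (\sum_(0 <= i <oo) (x i)%:E = l%:E)%E ->
  series x @ \oo --> l.
Proof.
move=> x0 xl.
have : (fun n => \sum_(0 <= i < n) (x i)%:E)%E @ \oo --> l%:E.
  by rewrite -xl; apply: is_cvg_nneseries => i _ _; rewrite lee_fin.
move=> /fine_cvg; apply: cvg_trans; apply: near_eq_cvg.
by apply: nearW => n; rewrite /= sumEFin.
Qed.

(** * Birth-death balance equations *)

Lemma inflow0 {R : realType} (lam : R) (mu F : nat -> R) :
  \sum_(i < 2) F i * bd_rate lam mu i 0 = mu 1%N * F 1%N.
Proof. by rewrite !big_ord_recr big_ord0 /= /bd_rate /= mulr0 !add0r mulrC. Qed.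

Lemma inflowS {R : realType} (lam : R) (mu F : nat -> R) (j : nat) :
  \sum_(i < j.+3) F i * bd_rate lam mu i j.+1 = lam * F j + mu j.+2 * F j.+2.
Proof.
rewrite !big_ord_recr big1 /= ?add0r => [|i _]; last first.
  by rewrite /bd_rate eqSS (gtn_eqF (ltn_ord i)) ltn_eqF ?mulr0// !leqW.
by rewrite /bd_rate !eqSS !eqxx !(ltn_eqF (ltnSn _)) ltn_eqF// mulr0 addr0 ![F _ * _]mulrC.
Qed.

Lemma exit_rate0 {R : realType} (lam : R) (mu : nat -> R) :
  exit_rate lam mu 0 = lam.
Proof. by rewrite /exit_rate !big_ord_recr big_ord0 /= /bd_rate /= !add0r. Qed.

Lemma exit_rateS {R : realType} (lam : R) (mu : nat -> R) (i : nat) :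
  exit_rate lam mu i.+1 = mu i.+1 + lam.
Proof.
rewrite /exit_rate !big_ord_recr big1 /= ?add0r => [|j _]; last first.
  have ji := ltn_ord j.
  by rewrite /bd_rate eqSS (gtn_eqF ji) ltn_eqF ?leqW.
by rewrite /bd_rate !eqSS !eqxx !(ltn_eqF (ltnSn _)) ltn_eqF// addr0.
Qed.

(** Summing the balance equations over the states [0..i] leaves only the flow
    across the cut between [i] and [i.+1]. *)
Lemma detailed_balanceP {R : realType} (lam : R) (mu pi : nat -> R) :
  (forall j, pi j * exit_rate lam mu j
             = \sum_(i < j.+2) pi i * bd_rate lam mu i j) <->
  (forall i, mu i.+1 * pi i.+1 = lam * pi i).
Proof.
split=> [bal|cut].
  elim=> [|i IH]; first by rewrite -(inflow0 lam) -bal exit_rate0 mulrC.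
  have := bal i.+1; rewrite inflowS exit_rateS mulrDr -IH mulrC => /addrI <-.
  by rewrite mulrC.
case=> [|i]; first by rewrite inflow0 exit_rate0 cut mulrC.
by rewrite inflowS exit_rateS (cut i.+1) -(cut i); ring.
Qed.

(** * Positive recurrence *)

Section PositiveRecurrence.
Context {R : realType}.
Variables (lam : R) (mu : nat -> R).
Hypotheses (lam_gt0 : 0 < lam) (mu_ge0 : forall i, 0 <= mu i).

Lemma bd_rate_ge0 i j : 0 <= bd_rate lam mu i j.
Proof. by rewrite /bd_rate; case: ifP => _; [exact: ltW|case: ifP]. Qed.

Lemma exit_rate_gt0 i : 0 < exit_rate lam mu i.
Proof.
by case: i => [|i]; rewrite ?exit_rate0// exit_rateS ltr_wpDl.
Qed.

Lemma excursion_ge0 x n j : 0 <= excursion lam mu x n j.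
Proof.
elim: n j => [|n IH] j /=; first exact: ler0n.
case: ifP => // _; apply: sumr_ge0 => i _.
by rewrite mulr_ge0// divr_ge0 ?bd_rate_ge0// ltW ?exit_rate_gt0.
Qed.

(** The right-hand side is invariant under the jump chain and equals 1 at [x],
    while the visits counted up to time [N.+1] come, away from [x], from one jump
    after the visits counted up to time [N]; so the bound follows by induction
    on the time horizon [N]. *)
Lemma sum_excursion_le (pi : nat -> R) x N j :
  (forall i, 0 <= pi i) -> 0 < pi x ->
  (forall j, pi j * exit_rate lam mu j
             = \sum_(i < j.+2) pi i * bd_rate lam mu i j) ->
  \sum_(0 <= n < N) excursion lam mu x n j
    <= pi j * exit_rate lam mu j / (pi x * exit_rate lam mu x).
Proof.
move=> pi_ge0 pix_gt0 bal.
have ex := exit_rate_gt0.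
have c_gt0 : 0 < pi x * exit_rate lam mu x by rewrite mulr_gt0.
elim: N j => [|N IH] j.
  by rewrite big_geq// divr_ge0 ?mulr_ge0// ltW.
(* Time 0 accounts for the only visit to x before the return. *)
rewrite big_nat_recl//=; have [->|jx] := eqVneq j x.
  by rewrite big1 ?addr0// divff ?lt0r_neq0.
rewrite add0r exchange_big /= bal mulr_suml; apply: ler_sum => i _.
rewrite -mulr_suml.
have rate_ge0 : 0 <= bd_rate lam mu i j / exit_rate lam mu i.
  by rewrite divr_ge0 ?bd_rate_ge0// ltW.
apply: le_trans (ler_wpM2r rate_ge0 (IH i)) _.
rewrite le_eqVlt; apply/orP; left; apply/eqP.
by field; rewrite !lt0r_neq0.
Qed.

(** Weighting the visit counts by the mean holding times turns the bound
    [sum_excursion_le] into [pi i / (pi x * exit_rate x)], which is summable. *)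
Lemma stationary_positive_recurrent (pi : nat -> R) :
  stationary lam mu pi -> (forall i, 0 < pi i) -> positive_recurrent lam mu.
Proof.
move=> [pi_ge0 pi1 bal] pi_gt0 x; rewrite /mean_return_time.
have ex := exit_rate_gt0.
have t_ge0 n i : (0 <= (excursion lam mu x n i / exit_rate lam mu i)%:E)%E.
  by rewrite lee_fin divr_ge0 ?excursion_ge0// ltW.
rewrite nneseries_interchange//.
set c := pi x * exit_rate lam mu x.
have c_gt0 : 0 < c by rewrite mulr_gt0.
apply: (@le_lt_trans _ _ (\sum_(0 <= i <oo) ((c^-1)%:E * (pi i)%:E))%E).
  apply: lee_nneseries => [i _ _|i _]; first exact: nneseries_ge0.
  apply: lime_le; first exact: is_cvg_nneseries.
  apply: nearW => N; rewrite sumEFin -EFinM lee_fin -mulr_suml.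
  rewrite ler_pdivrMr// [leRHS](_ : _ = pi i * exit_rate lam mu i / c).
    exact: sum_excursion_le.
  by field; rewrite lt0r_neq0.
rewrite nneseriesZl ?pi1 ?mule1 ?ltry// => i _.
by rewrite lee_fin.
Qed.

End PositiveRecurrence.

(** * Truncated excess moments *)

(** The truncated subtraction makes this the partial sum of [E (N - k)^+]; at
    [k = 0] it is that of the mean. *)
Definition excess {R : realType} (x : nat -> R) (k : nat) : nat -> R :=
  series (fun i => (i - k)%:R * x i).

Section Excess.
Context {R : realType}.
Implicit Types (x : nat -> R) (r : R).

(** Increasing the excess of every state [i >= k] by one adds the mass of these
    states. *)
Lemma excess_next x k N : (k <= N)%N ->
  \sum_(0 <= i < N) (i.+1 - k)%:R * x i
    = excess x k N + (series x N - series x k).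
Proof.
move=> /subnK <-; elim: (N - k)%N => [|d IH].
  rewrite add0n subrr addr0; apply: eq_big_nat => i /andP[_ ik].
  by rewrite (eqP ik) (eqP (ltnW ik : (i - k)%N == 0%N)).
rewrite addSn big_nat_recr//= IH /excess !seriesSr.
by rewrite subSn ?leq_addl// -addn1 natrD; ring.
Qed.

(** Truncated form of [E[N] = P(N > 0) + ... + P(N > k - 1) + E (N - k)^+]. *)
Lemma excess0_tails x k N : (k <= N)%N ->
  excess x 0 N = \sum_(j < k) (series x N - series x j.+1) + excess x k N.
Proof.
elim: k => [|k IH] kN; first by rewrite big_ord0 add0r.
rewrite IH ?(ltnW kN)// big_ord_recr /= -addrA; congr (_ + _).
by rewrite addrC -excess_next//.
Qed.

Lemma excess_recl x k N :
  excess x k N.+1 = \sum_(0 <= i < N) (i.+1 - k)%:R * x i.+1.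
Proof. by rewrite /excess /series /= big_nat_recl//= mul0r add0r. Qed.

Lemma nondecreasing_excess x k :
  (forall i, 0 <= x i) -> nondecreasing_seq (excess x k).
Proof.
by move=> x0; apply: nondecreasing_series => i _ _; rewrite mulr_ge0.
Qed.

(** Shifting the index by one compares the excess with [r] times itself plus the
    tail mass. In the limit this is [E (N - k)^+ >= r (E (N - k)^+ + P(N >= k))],
    that is [E (N - k)^+ >= r / (1 - r) P(N >= k)]. *)
Lemma excess_ge x r k N : (k <= N)%N -> 0 <= r ->
  (forall i, r * x i <= x i.+1) ->
  r * (excess x k N + (series x N - series x k)) <= excess x k N.+1.
Proof.
move=> kN r0 rx; rewrite excess_recl -excess_next// mulr_sumr.
by apply: ler_sum => i _; rewrite mulrCA ler_wpM2l.
Qed.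

(** The reverse comparison needs no limit, as the partial sums of the excess
    increase with [N]. *)
Lemma excess_le x r k N : (k <= N)%N -> 0 <= r < 1 -> (forall i, 0 <= x i) ->
  (forall i, (k <= i)%N -> x i.+1 <= r * x i) ->
  excess x k N <= r / (1 - r) * (series x N - series x k).
Proof.
move=> kN /andP[r0 r1] x0 xr.
have : excess x k N.+1 <= r * (excess x k N + (series x N - series x k)).
  rewrite excess_recl -excess_next// mulr_sumr.
  apply: ler_sum => i _; rewrite mulrCA; have [ki|ik] := leqP k i.
    by rewrite ler_wpM2l ?xr.
  by rewrite (eqP ik) !mul0r.
have := nondecreasing_excess x k x0 _ _ (leqnSn N).
move=> /le_trans /[apply] le.
rewrite mulrAC ler_pdivlMr ?subr_gt0//; lra.
Qed.

End Excess.

(** * Affine lower bounds on the mean *)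

Section MeanBounds.
Context {R : realType}.
Variables (r s : R).
Hypotheses (r01 : 0 <= r < 1) (s_ge0 : 0 <= s).

Let geo (n : nat) : R := series (geometric 1 s) n.

(** Sums [1 - a * (1 + ... + s ^ j)], the lower bound on [P(N > j)], over
    [j < k], and adds [r / (1 - r)] times the same bound on [P(N >= k)];
    [mean_slope k] collects the coefficient of [- a]. *)
Definition mean_slope (k : nat) : R :=
  \sum_(j < k) series (geometric 1 s) j.+1
  + r / (1 - r) * series (geometric 1 s) k.

Definition mean_bound (k : nat) (a : R) : R :=
  k%:R + r / (1 - r) - a * mean_slope k.

Lemma geoS n : geo n.+1 = geo n + s ^+ n.
Proof. by rewrite /geo seriesSr /geometric /= mul1r. Qed.

Lemma geo0 : geo 0 = 0.
Proof. by rewrite /geo /series /= big_geq. Qed.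

Lemma mean_slope0 : mean_slope 0 = 0.
Proof. by rewrite /mean_slope big_ord0 add0r -/(geo 0) geo0 mulr0. Qed.

Lemma mean_slopeS k :
  mean_slope k.+1
    = mean_slope k + (series (geometric 1 s) k + s ^+ k / (1 - r)).
Proof.
rewrite /mean_slope big_ord_recr /= -/(geo k.+1) -/(geo k) geoS.
by field; case/andP: r01 => _ r1; rewrite subr_eq0 gt_eqF.
Qed.

Lemma mean_slope_ge k : k%:R <= mean_slope k.
Proof.
have geo_ge0 n : 0 <= geo n.
  by elim: n => [|n IH]; rewrite ?geo0// geoS addr_ge0// exprn_ge0.
have geoS_ge1 n : 1 <= geo n.+1.
  elim: n => [|n IH]; first by rewrite geoS geo0 add0r.
  by rewrite geoS (le_trans IH)// lerDl exprn_ge0.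
case/andP: r01 => r0 r1.
rewrite /mean_slope -[leLHS]addr0 lerD//; last first.
  by rewrite mulr_ge0// divr_ge0// subr_ge0 ltW.
rewrite -[X in X%:R](card_ord k) -sumr_const.
by apply: ler_sum => j _; exact: geoS_ge1.
Qed.

Lemma sum_tails_cvg (x : nat -> R) k :
  series x @ \oo --> (1 : R) ->
  (fun N => \sum_(j < k) (series x N - series x j.+1)) @ \oo
    --> k%:R - \sum_(j < k) series x j.+1.
Proof.
move=> x1.
have -> : (fun N => \sum_(j < k) (series x N - series x j.+1))
    = (fun N => series x N * k%:R - \sum_(j < k) series x j.+1).
  by apply/funext => N; rewrite sumrB sumr_const card_ord mulr_natr.
rewrite -[X in _ --> X - _]mul1r; apply: cvgB; last exact: cvg_cst.
by apply: cvgM => //; exact: cvg_cst.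
Qed.

Lemma mean_bound_lower (x : nat -> R) (E : R) k :
  (forall i, 0 <= x i) -> series x @ \oo --> (1 : R) ->
  (forall i, r * x i <= x i.+1 <= s * x i) ->
  (forall N, excess x 0 N <= E) -> mean_bound k (x 0%N) <= E.
Proof.
move=> x_ge0 x1 ratio meanE; case/andP: (r01) => r0 r1.
have x_le i : x i <= x 0%N * s ^+ i.
  elim: i => [|i IH]; first by rewrite mulr1.
  have /andP[_ le] := ratio i; apply: le_trans le _.
  by rewrite exprS mulrCA ler_wpM2l.
have series_le n : series x n <= x 0%N * geo n.
  rewrite /geo /series /= mulr_sumr; apply: ler_sum => i _.
  by rewrite /geometric /= mul1r.
have exE N : excess x k N <= E.
  apply: le_trans (meanE N); apply: ler_sum => i _.
  by rewrite ler_wpM2r// ler_nat subn0 leq_subr.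
have : cvgn (excess x k).
  apply: nondecreasing_is_cvgn; first exact: nondecreasing_excess.
  by exists E => _ [N _ <-].
(* F is E (N - k)^+. *)
move: (lim _) => F /= exF.
have F_ge : r * (F + (1 - series x k)) <= F.
  have exS : (fun N => excess x k N.+1) @ \oo --> F by rewrite cvg_shiftS.
  have rS : (fun N => r * (excess x k N + (series x N - series x k))) @ \oo
      --> r * (F + (1 - series x k)).
    apply: cvgM; first exact: cvg_cst.
    by apply: cvgD => //; apply: cvgB => //; exact: cvg_cst.
  apply: ler_cvg_to rS exS _.
  by exists k => // N /= kN; apply: excess_ge => // i; case/andP: (ratio i).
have E_ge : k%:R - \sum_(j < k) series x j.+1 + F <= E.
  apply: cvgr_to_le (cvgD (sum_tails_cvg x k x1) exF) _.
  by exists k => // N kN; have := meanE N; rewrite (excess0_tails x k N kN).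
apply: le_trans E_ge.
have sum_le : \sum_(j < k) series x j.+1 <= x 0%N * \sum_(j < k) geo j.+1.
  by rewrite mulr_sumr; apply: ler_sum => j _.
have F_le : r / (1 - r) * (1 - x 0%N * geo k) <= F.
  rewrite mulrAC ler_pdivrMr ?subr_gt0//.
  have := ler_wpM2l r0 (series_le k); lra.
rewrite /mean_bound /mean_slope -/(geo k); lra.
Qed.

(** Ratio exactly [s] up to [k] and at most [r] from there on reverses every
    inequality behind [mean_bound_lower]. *)
Lemma mean_bound_attained (x : nat -> R) k N :
  (forall i, 0 <= x i) -> series x @ \oo --> (1 : R) ->
  (forall i, (i <= k)%N -> x i = x 0%N * s ^+ i) ->
  (forall i, (k <= i)%N -> x i.+1 <= r * x i) ->
  excess x 0 N <= mean_bound k (x 0%N).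
Proof.
move=> x_ge0 x1 x_eq xr; case/andP: (r01) => r0 r1.
have series_eq n : (n <= k.+1)%N -> series x n = x 0%N * geo n.
  move=> nk; rewrite /geo /series /= mulr_sumr; apply: eq_big_nat => i /= lin.
  by rewrite /geometric /= mul1r x_eq// -ltnS (leq_trans lin).
have series_le1 n : series x n <= 1.
  rewrite -(cvg_lim (@Rhausdorff R) x1); apply: nondecreasing_cvgn_le.
    by apply: nondecreasing_series => i _ _.
  exact: cvgP x1.
apply: le_trans (nondecreasing_excess x 0 x_ge0 _ _ (leq_addl k N)) _.
have kN : (k <= k + N)%N by exact: leq_addr.
rewrite (excess0_tails x k _ kN) sumrB sumr_const card_ord -mulr_natl.
have -> : \sum_(j < k) series x j.+1 = x 0%N * \sum_(j < k) geo j.+1.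
  by rewrite mulr_sumr; apply: eq_bigr => j _; rewrite series_eq// ltnS ltnW.
have rho_ge0 : 0 <= r / (1 - r) by rewrite divr_ge0// subr_ge0 ltW.
have := excess_le x r k _ kN r01 x_ge0 xr; rewrite (series_eq k)//.
have := ler_wpM2l rho_ge0 (series_le1 (k + N)%N).
have := ler_wpM2l (ler0n R k) (series_le1 (k + N)%N).
rewrite /mean_bound /mean_slope -/(geo k); lra.
Qed.

(** * Bang-bang distributions *)

(** The probability of state 0 that normalizes [bang_bang_dist]. *)
Definition bang_bang_mass (K : nat) : R :=
  (series (geometric 1 s) K + s ^+ K / (1 - r))^-1.

Definition bang_bang_dist (K i : nat) : R :=
  bang_bang_mass K * s ^+ (minn i K) * r ^+ (i - K).

Lemma bang_bang_dist0 K : bang_bang_dist K 0 = bang_bang_mass K.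
Proof. by rewrite /bang_bang_dist min0n sub0n !mulr1. Qed.

Lemma bang_bang_mass_denom_gt0 K : 0 < s ->
  0 < series (geometric 1 s) K + s ^+ K / (1 - r).
Proof.
move=> s_gt0; rewrite ltr_wpDl ?divr_gt0 ?exprn_gt0 ?subr_gt0//; last first.
  by case/andP: r01.
by apply: sumr_ge0 => i _; rewrite /geometric /= mul1r exprn_ge0.
Qed.

(** The gap between two consecutive lines at [a] is
    [1 - a * (geo K + s ^ K / (1 - r))], which vanishes exactly at the
    normalizing mass, where [geo K] is [1 + ... + s ^ (K - 1)]. *)
Lemma mean_boundS_bang_bang K : 0 < s ->
  mean_bound K.+1 (bang_bang_mass K) = mean_bound K (bang_bang_mass K).
Proof.
move=> s_gt0; case/andP: (r01) => r0 r1.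
have mass1 : bang_bang_mass K * (geo K + s ^+ K / (1 - r)) = 1.
  by rewrite mulVf// gt_eqF// bang_bang_mass_denom_gt0.
rewrite /mean_bound mean_slopeS -/(geo K) mulrDr mass1 -natr1; ring.
Qed.

Lemma bang_bang_dist_gt0 K i : 0 < r -> 0 < s -> 0 < bang_bang_dist K i.
Proof.
move=> r_gt0 s_gt0; rewrite /bang_bang_dist !mulr_gt0 ?exprn_gt0//.
by rewrite invr_gt0 bang_bang_mass_denom_gt0.
Qed.

Lemma bang_bang_distS K i :
  bang_bang_dist K i.+1 = (if (i < K)%N then s else r) * bang_bang_dist K i.
Proof.
rewrite /bang_bang_dist; case: ltnP => iK.
  rewrite (minn_idPl iK) (eqP iK).
  by rewrite (eqP (ltnW iK : (i - K)%N == 0%N)) exprS; ring.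
rewrite (minn_idPr (leqW iK)) subSn// exprS; ring.
Qed.

Lemma bang_bang_dist_cvg K : 0 < s ->
  series (bang_bang_dist K) @ \oo --> (1 : R).
Proof.
move=> s_gt0; case/andP: (r01) => r0 r1.
set a := bang_bang_mass K.
have mass1 : a * (geo K + s ^+ K / (1 - r)) = 1.
  by rewrite mulVf// gt_eqF// bang_bang_mass_denom_gt0.
rewrite -(cvg_shiftn K).
have -> : [sequence series (bang_bang_dist K) (n + K)%N]_n
    = (fun n => a * geo K + series (geometric (a * s ^+ K) r) n).
  apply/funext => n /=; rewrite series_addn; congr (_ + _).
    rewrite /geo /series /= mulr_sumr; apply: eq_big_nat => i /= iK.
    rewrite /bang_bang_dist (minn_idPl (ltnW iK)).
    by rewrite (eqP (ltnW iK : (i - K)%N == 0%N)) /geometric /= mul1r mulr1.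
  rewrite /series /= -{1}[K]add0n big_addn addnK; apply: eq_big_nat => i _.
  by rewrite /bang_bang_dist addnK (minn_idPr (leq_addl i K)).
rewrite -mass1 mulrDr mulrA; apply: cvgD; first exact: cvg_cst.
by apply: cvg_geometric_series; rewrite ger0_norm.
Qed.

End MeanBounds.

(** * Optimality of the kink *)

Section Optimality.
Context {R : realType}.

(** Writing [p i = (beta - mu i) / alpha] and using [mu i.+1 * pi i.+1 = lam * pi i],
    the departure terms sum to [lam / alpha], whatever the prices. The rate
    [mu 0] enters only because state 0 also earns its posted price. *)
Lemma revenue (alpha beta lam : R) (mu p pi : nat -> R) :
  alpha != 0 -> (forall i, mu i = beta - alpha * p i) ->
  stationary lam mu pi ->
  (\sum_(0 <= i <oo) (pi i * p i)%:E
   = ((beta - lam) / alpha - mu 0%N / alpha * pi 0%N)%:E)%E.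
Proof.
move=> alpha_neq0 mu_eq [pi_ge0 pi_sum /detailed_balanceP cut].
have pi1 := nneseries_EFin_cvg _ _ pi_ge0 pi_sum.
apply: cvg_nneseries_EFin.
have p_eq i : p i = (beta - mu i) / alpha by rewrite mu_eq; field.
have partial N : series (fun i => pi i * p i) N.+1
    = beta / alpha * series pi N.+1 - lam / alpha * series pi N
      - mu 0%N / alpha * pi 0%N.
  elim: N => [|N IH].
    by rewrite !seriesSr /series /= !big_geq// p_eq; field.
  rewrite seriesSr IH !(seriesSr pi) p_eq.
  have -> : pi N.+1 * ((beta - mu N.+1) / alpha)
      = beta / alpha * pi N.+1 - mu N.+1 * pi N.+1 / alpha by field.
  by rewrite cut; field.
rewrite -cvg_shiftS; under eq_cvg => N do rewrite /= partial.
rewrite mulrBl -[X in X - _ - _]mulr1 -[X in _ - X - _]mulr1.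
have pi1S : (fun N => series pi N.+1) @ \oo --> (1 : R) by rewrite cvg_shiftS.
apply: cvgB; last exact: cvg_cst.
by apply: cvgB; apply: cvgM => //; exact: cvg_cst.
Qed.

Lemma mean_excess (pi : nat -> R) (E : R) : (forall i, 0 <= pi i) ->
  (\sum_(1 <= i <oo) (i%:R * pi i)%:E <= E%:E)%E
  <-> forall N, excess pi 0 N <= E.
Proof.
move=> pi_ge0.
have t_ge0 i : (0 <= (i%:R * pi i)%:E)%E by rewrite lee_fin mulr_ge0.
have -> : (\sum_(1 <= i <oo) (i%:R * pi i)%:E
    = \sum_(0 <= i <oo) (i%:R * pi i)%:E)%E.
  by rewrite [RHS]nneseries_recl// mul0r add0e.
have exE N : (excess pi 0 N)%:E = (\sum_(0 <= i < N) (i%:R * pi i)%:E)%E.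
  by rewrite sumEFin; congr EFin; apply: eq_bigr => i _; rewrite subn0.
split=> [sum_le N|part_le].
  rewrite -lee_fin exE; apply: le_trans sum_le.
  by apply: nneseries_lim_ge => i _ _.
apply: lime_le; first by apply: is_cvg_nneseries => i _ _.
by apply: nearW => N; rewrite -exE lee_fin.
Qed.

(** The lines of index [K] and [K.+1] meet at [b]; the cost along the former is
    nondecreasing in [a], which settles [b <= a], and along the latter it is
    nonincreasing, which settles [a <= b]. *)
Lemma cost_ge_at_kink (r s c w a b E : R) K :
  0 <= w ->
  w * mean_slope r s K <= c <= w * mean_slope r s K.+1 ->
  mean_bound r s K.+1 b = mean_bound r s K b ->
  mean_bound r s K a <= E -> mean_bound r s K.+1 a <= E ->
  c * b + w * mean_bound r s K b <= c * a + w * E.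
Proof.
move=> w_ge0 /andP[slope_le slope_ge] bE Ea EaS.
have [ba|/ltW ab] := leP b a.
  apply: le_trans (_ : c * a + w * mean_bound r s K a <= _); last first.
    by rewrite lerD2l ler_wpM2l.
  have : 0 <= (a - b) * (c - w * mean_slope r s K).
    by rewrite mulr_ge0// subr_ge0.
  by rewrite /mean_bound; lra.
rewrite -bE.
apply: le_trans (_ : c * a + w * mean_bound r s K.+1 a <= _); last first.
  by rewrite lerD2l ler_wpM2l.
have : 0 <= (b - a) * (w * mean_slope r s K.+1 - c).
  by rewrite mulr_ge0// subr_ge0.
by rewrite /mean_bound; lra.
Qed.

Lemma slope_threshold (r s c w : R) : 0 <= r < 1 -> 0 <= s -> 0 <= c -> 0 < w ->
  exists K, w * mean_slope r s K <= c <= w * mean_slope r s K.+1.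
Proof.
move=> r01 s_ge0 c_ge0 w_gt0.
have large : exists K, c <= w * mean_slope r s K.+1.
  have cw_ge0 : 0 <= c / w by rewrite divr_ge0// ltW.
  exists (Num.Def.archi_bound (c / w)).
  rewrite mulrC -ler_pdivrMr//; apply: le_trans (mean_slope_ge r s r01 s_ge0 _).
  by rewrite (le_trans (ltW (archi_boundP cw_ge0)))// ler_nat.
case: (ex_minnP large) => K cK Kmin; exists K; rewrite cK andbT.
case: K Kmin {cK} => [|K] Kmin; first by rewrite mean_slope0 mulr0.
by rewrite leNgt; apply/negP => /ltW/Kmin; rewrite ltnn.
Qed.

End Optimality.

Theorem theorem3 (R : realType) (lam w pmin pmax alpha beta : R) (g : R -> R)
    (lam_gt0 : 0 < lam) (w_gt0 : 0 < w)
    (pmin_gt0 : 0 < pmin) (pmin_lt_pmax : pmin < pmax)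
    (alpha_gt0 : 0 < alpha) (beta_gt0 : 0 < beta)
    (g_linear : forall x, g x = beta - alpha * x)
    (mu_max_gt : lam < beta - alpha * pmin)
    (mu_min_gt0 : 0 < beta - alpha * pmax) :
  exists (p : nat -> R) (l : option nat) (pstar : R),
    [/\ optimal_policy lam w pmin pmax g p,
        forall k : nat, l = Some k -> (1 <= k)%N,
        pmin <= pstar <= pmax &
        forall i : nat, p i = threshold_price pmin pmax l pstar i].
Proof.
pose mumax := beta - alpha * pmin; pose mumin := beta - alpha * pmax.
have mumax_gt0 : 0 < mumax by exact: lt_trans mu_max_gt.
pose r := lam / mumax; pose s := lam / mumin.
have r_gt0 : 0 < r by rewrite divr_gt0.
have s_gt0 : 0 < s by rewrite divr_gt0.
have s_ge0 := ltW s_gt0.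
have r01 : 0 <= r < 1 by rewrite ltW//= ltr_pdivrMr ?mul1r.
have c_ge0 : 0 <= mumin / alpha by rewrite divr_ge0// ltW.
have alpha_neq0 : alpha != 0 by rewrite gt_eqF.
have [K slopeK] := slope_threshold r s (mumin / alpha) w r01 s_ge0 c_ge0 w_gt0.
(* Prices pmax up to state K and pmin above it. *)
pose p := threshold_price pmin pmax (Some K.+1) pmin.
have pS i : p i.+1 = if (i < K)%N then pmax else pmin.
  by rewrite /p /= ltnS; case: ltnP => // _; rewrite if_same.
pose pi := bang_bang_dist r s K.
have pi_gt0 i : 0 < pi i by exact: bang_bang_dist_gt0.
have pi_ge0 i : 0 <= pi i by exact: ltW.
have pi1 : series pi @ \oo --> (1 : R) by exact: bang_bang_dist_cvg.
have pi_stat : stationary lam (g \o p) pi.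
  split=> //; first exact: cvg_nneseries_EFin.
  apply/detailed_balanceP => i.
  rewrite /= g_linear pS /pi bang_bang_distS.
  by case: ifP => _; rewrite /r /s /mumax /mumin; field; rewrite gt_eqF.
have p_range i : pmin <= p i <= pmax.
  case: i => [|i]; first by rewrite /p /= lexx ltW.
  by rewrite pS; case: ifP => _; rewrite lexx ltW.
have mu_ge q : pmin <= q <= pmax -> mumin <= g q <= mumax.
  case/andP=> q1 q2; rewrite g_linear /mumin /mumax !lerD2l !lerN2.
  by rewrite !ler_pM2l// q1 q2.
have p_pol : policy lam pmin pmax g p.
  split=> // x; apply: stationary_positive_recurrent pi_stat pi_gt0 x => // i.
  by have /andP[+ _] := mu_ge _ (p_range i); apply/le_trans/ltW.
exists p, (Some K.+1), pmin; split=> //; first last.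
- by rewrite lexx ltW.
- by move=> _ [<-].
split=> //; exists pi => // q rho [q0 q_range _] rho_stat.
have rev (v sigma : nat -> R) : v 0%N = pmax -> stationary lam (g \o v) sigma ->
    (\sum_(0 <= i <oo) (sigma i * v i)%:E
     = ((beta - lam) / alpha - mumin / alpha * sigma 0%N)%:E)%E.
  move=> v0 sigma_stat.
  have -> : mumin = (g \o v) 0%N by rewrite /= v0 g_linear.
  by apply: revenue sigma_stat => // i; rewrite /= g_linear.
rewrite /C_rel !rev//.
have [rho_ge0 rho_sum /detailed_balanceP cut] := rho_stat.
have rho1 := nneseries_EFin_cvg _ _ rho_ge0 rho_sum.
set Ep := (\sum_(1 <= i <oo) (i%:R * pi i)%:E)%E.
set Eq := (\sum_(1 <= i <oo) (i%:R * rho i)%:E)%E.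
have Ep_ge0 : (0 <= Ep)%E.
  by apply: nneseries_ge0 => i _ _; rewrite lee_fin mulr_ge0.
have Eq_ge0 : (0 <= Eq)%E.
  by apply: nneseries_ge0 => i _ _; rewrite lee_fin mulr_ge0.
have Ep_le : (Ep <= (mean_bound r s K (pi 0%N))%:E)%E.
  apply/mean_excess => // N; apply: mean_bound_attained => // i iK.
    by rewrite /pi /bang_bang_dist min0n sub0n (minn_idPl iK) (eqP iK) !mulr1.
  by rewrite /pi bang_bang_distS ltnNge iK.
have Ep_fin : Ep \is a fin_num by rewrite ge0_fin_numE// (le_lt_trans Ep_le)// ltry.
(* A competitor with infinite mean has objective -oo. *)
have [Eq_oo|Eq_fin] := eqVneq Eq +oo%E.
  by rewrite Eq_oo gt0_muley ?lte_fin// addeNy leNye.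
have {}Eq_fin : Eq \is a fin_num by rewrite ge0_fin_numE// ltey.
have Eq_ge k : mean_bound r s k (rho 0%N) <= fine Eq.
  apply: mean_bound_lower => // [i|N].
    have /andP[lo hi] := mu_ge _ (q_range i.+1 isT).
    have lo_gt0 := lt_le_trans mu_min_gt0 lo.
    have := cut i => /= bal.
    rewrite /r /s mulrAC ler_pdivrMr// mulrAC ler_pdivlMr// -bal.
    by rewrite ![rho _ * _]mulrC !ler_wpM2r.
  by move: N; apply/mean_excess => //; rewrite fineK.
rewrite -(fineK Ep_fin) -(fineK Eq_fin) -!EFinM -!EFinB lee_fin.
have Ep_le' : fine Ep <= mean_bound r s K (pi 0%N).
  by rewrite -lee_fin fineK.
have bE : mean_bound r s K.+1 (pi 0%N) = mean_bound r s K (pi 0%N).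
  by rewrite /pi bang_bang_dist0 mean_boundS_bang_bang.
have := cost_ge_at_kink r s _ w _ _ _ K (ltW w_gt0) slopeK bE (Eq_ge K) (Eq_ge K.+1).
have := ler_wpM2l (ltW w_gt0) Ep_le'.
lra.
Qed.
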